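(* Let $m\ge 2$ be an integer. The number of $\mathbb{F}_{2^m}$-linear MRD codes of dimension two in $\mathcal{L}_{m,2}[x]$ is $$\frac{\varphi(m)}{2}\cdot\frac{|\mathrm{GL}_m(2)|}{2^m-1},$$ where $\varphi$ is Euler's totient function.
   Context: For a prime power $q$ and $m\ge 1$, $\mathcal{L}_{m,q}[x]$ is the set of linearized polynomials $f=\sum_{i=0}^{m-1} f_i x^{q^i}$ with $f_i\in\mathbb{F}_{q^m}$ (i.e. $q$-polynomials modulo $x^{q^m}-x$), an $m$-dimensional $\mathbb{F}_{q^m}$-vector space under left multiplication by scalars, identified with $\mathrm{End}_{\mathbb{F}_q}(\mathbb{F}_{q^m})$ via evaluation. The rank of $f$ is $\mathrm{rk}(f)=\dim_{\mathbb{F}_q}(\mathrm{Im} f)$. An $\mathbb{F}_{q^m}$-linear rank-metric code in $\mathcal{L}_{m,q}[x]$ is a nonzero $\mathbb{F}_{q^m}$-linear subspace; its dimension is its $\mathbb{F}_{q^m}$-dimension. A code of dimension $k$ is MRD if the minimum rank of its nonzero elements equals $m-k+1$. $\mathrm{GL}_m(q)$ is the group of invertible $m\times m$ matrices over $\mathbb{F}_q$. *)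

(* Defs.v *)
From HB Require Import structures.
From mathcomp Require Import all_boot all_order all_fingroup all_algebra all_field.

Set Implicit Arguments.
Unset Strict Implicit.
Unset Printing Implicit Defensive.

Import GRing.Theory.
Local Open Scope ring_scope.

Section LinearizedPolynomials.

(* F is the field with q elements and L its extension of degree m
   (so that \dim {:L} = m in the intended use).
   The linearized polynomial f_0 x + f_1 x^q + ... + f_(m-1) x^(q^(m-1)) is
   represented by its row of coefficients in L; the L-space structure of 'rV_m
   is then left multiplication of the polynomial by scalars, and an L-linear
   code is a {vspace 'rV[L]_m}. *)
Variables (F : finFieldType) (L : fieldExtType F) (m : nat).
Implicit Types (f : 'rV[L]_m) (C : {vspace 'rV[L]_m}).

Definition linpoly f : {poly L} :=
  \sum_(i < m) f 0 i *: 'X^(#|F| ^ i).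

Definition lin_eval f : L -> L := fun x => (linpoly f).[x].

Lemma lin_evalE f x : lin_eval f x = \sum_(i < m) f 0 i * x ^+ (#|F| ^ i).
Proof.
rewrite /lin_eval /linpoly horner_sum.
by apply: eq_bigr => i _; rewrite hornerZ hornerXn.
Qed.

Lemma lin_eval_is_linear f : linear (lin_eval f).
Proof.
move=> a x y; rewrite !lin_evalE scaler_sumr -big_split /=.
apply: eq_bigr => i _; rewrite scalerAr -mulrDr; congr (_ * _).
elim: (nat_of_ord i) => [|n IHn]; first by rewrite !expr1.
rewrite expnSr !exprM IHn.
have [p p_pr pF] := finPcharP F.
have pL : p \in [pchar L] by rewrite pchar_lalg.
rewrite exprDn_pchar ?exprZn ?expf_card //.
rewrite (card_pprimeChar pF) pnatX (eq_pnat _ (pcharf_eq pL)).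
by rewrite pnat_id.
Qed.

HB.instance Definition _ f :=
  GRing.isLinear.Build F L L *:%R (lin_eval f) (lin_eval_is_linear f).

Definition lin_rank f : nat := \dim (limg (linfun (lin_eval f))).

(* The nonzero elements of C have minimum rank d. *)
Definition is_min_rank C (d : nat) : Prop :=
  (exists f, [/\ f \in C, f != 0 & lin_rank f = d]) /\
  (forall f, f \in C -> f != 0 -> (d <= lin_rank f)%N).

(* Truncated subtraction is harmless, since k = \dim C <= m. *)
Definition is_MRD (k : nat) C : Prop :=
  [/\ C != 0%VS, \dim C = k & is_min_rank C (m - k + 1)].

End LinearizedPolynomials.

(* Main.v *)
Require Import Defs.
From HB Require Import structures.
From mathcomp Require Import all_boot all_order all_fingroup all_algebra all_field.

Set Implicit Arguments.
Unset Strict Implicit.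
Unset Printing Implicit Defensive.

Import GRing.Theory passmx.
Local Open Scope ring_scope.

(* Count the pairs (C, A) of an MRD code C of dimension two and an invertible
   A in C. With q = 2^m, a code C is MRD if and only if its nonzero elements
   have kernels of order at most two. For each x != 0 the elements of C
   vanishing at x form a line, and these q - 1 lines meet only at 0; hence C
   contains (q^2 - 1) - (q - 1)^2 = 2 (q - 1) invertible elements. Conversely,
   the codes containing a given invertible A are the <A, A^(2^s)> with s prime
   to m, which gives #codes * 2 (q - 1) = |GL_m(2)| * phi(m).

   The last point reduces, by composing with the inverse of A, to Payne's
   theorem: if f is linearized without linear term and f(x)/x is injective on
   nonzero x, then f = c x^(2^s) with s prime to m. Let P(X) be the
   determinant of the matrix with diagonal entries X^(2^i) and off-diagonal
   entries f_(i-j)^(2^j). Every f(x)/x is a root of P, and P has no term of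
   degree q - 2, so that P = X^(q-1) - 1. The coefficient of P at
   sum_(i notin W) 2^i is the sum over the fixed-point-free permutations of W
   of the products of entries. Take W minimal among the nonempty vertex sets of
   the digraph { (i, j) | f_(i-j) != 0 } in which every vertex has a successor:
   then each vertex has exactly one successor in W, a single permutation
   contributes, and so W consists of all the vertices. *)

(** * Payne's theorem *)

Section Sinkless.

Variables (T : finType) (e : rel T).

Definition sinkless (W : {set T}) :=
  (W != set0) && [forall x in W, exists y in W, e x y].

Lemma sinkless_imset (h : T -> T) (W : {set T}) :
    W != set0 -> {in W, forall x, (h x \in W) && e x (h x)} ->
  sinkless (h @: W).
Proof.
move=> /set0Pn[x0 Wx0] hW; apply/andP; split.
  by apply/set0Pn; exists (h x0); apply: imset_f.
apply/'forall_implyP => _ /imsetP[x Wx ->].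
have /andP[Whx _] := hW x Wx; have /andP[_ ehx] := hW _ Whx.
by apply/'exists_andP; exists (h (h x)); split; first exact: imset_f.
Qed.

(** Any choice of successors inside [W] has a sinkless image, which is all of [W] by minimality, so
    the choice permutes [W]. Two choices differing at a single vertex cannot both be
    permutations. *)
Lemma minset_sinkless_out (W : {set T}) :
    minset sinkless W ->
  exists2 h : T -> T, {in W, forall x, (h x \in W) && e x (h x)}
    & {in W &, injective h}
      /\ {in W &, forall x y, e x y -> y = h x}.
Proof.
move=> /minsetP[/andP[Wn0 /'forall_implyP Wout] Wmin].
have hinj (h : T -> T) : {in W, forall x, (h x \in W) && e x (h x)} ->
    {in W &, injective h}.
  move=> hW; apply/imset_injP; rewrite (Wmin (h @: W)) //.
    exact: sinkless_imset.
  by apply/subsetP=> _ /imsetP[x /hW /andP[Whx _] ->].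
pose h x := odflt x [pick y in W | e x y].
have hW : {in W, forall x, (h x \in W) && e x (h x)}.
  move=> x Wx; rewrite /h; case: pickP => [y //|/= noy].
  by have /'exists_andP[y [Wy exy]] := Wout x Wx; have := noy y; rewrite Wy exy.
exists h => //; split; first exact: hinj.
move=> x y Wx Wy exy; case: (eqVneq y (h x)) => // ynhx; exfalso.
(* Redirecting [x] to [y] keeps a choice of successors, hence an injection
   of [W]; but [y] already has a preimage under [h], distinct from [x]. *)
pose h' z := if z == x then y else h z.
have h'W : {in W, forall x, (h' x \in W) && e x (h' x)}.
  by move=> z Wz; rewrite /h'; case: eqP => [->|_]; [rewrite Wy | apply: hW].
have /imsetP[z Wz yz] : y \in h @: W.
  rewrite (Wmin (h @: W)) //; first exact: sinkless_imset.
  by apply/subsetP=> _ /imsetP[z /hW /andP[Whz _] ->].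
have znx : z != x by apply: contraNneq ynhx => <-; rewrite yz.
have := hinj h' h'W z x Wz Wx; rewrite /h' eqxx (negPf znx) -yz => /(_ erefl).
by move/eqP; rewrite (negPf znx).
Qed.

End Sinkless.

(** Uniqueness of binary expansions: parity gives the lowest digit, halving the others. It recovers
    the fixed points of a permutation from the exponent of its term in the determinant. *)
Lemma sum_exp2_inj n : injective (fun S : {set 'I_n} => \sum_(i in S) 2 ^ i)%N.
Proof.
have aux (a b : nat -> bool) k : (\sum_(i < k) a i * 2 ^ i =
    \sum_(i < k) b i * 2 ^ i)%N -> forall i, (i < k)%N -> a i = b i.
  elim: k a b => [|k IHk] a b //; rewrite !big_ord_recl !expn0 !muln1 /=.
  under eq_bigr do rewrite expnS mulnCA; rewrite -big_distrr /=.
  under [X in _ = (_ + X)%N]eq_bigr do rewrite expnS mulnCA.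
  rewrite -big_distrr /= !mul2n => eqab.
  have ab0 : a 0%N = b 0%N.
    by have := congr1 odd eqab; rewrite !oddD !odd_double !addbF !oddb.
  move: eqab; rewrite ab0 => /addnI /double_inj /(IHk (a \o S) (b \o S)) eqS.
  case=> [|i] // ltik.
  exact: eqS.
move=> S T /= eqST; apply/setP => i.
pose mem S j := if insub j is Some i then i \in (S : {set 'I_n}) else false.
have memE S' (j : 'I_n) : mem S' j = (j \in S') by rewrite /mem valK.
rewrite -!memE; apply: (aux _ _ n) => //.
have sumE (S' : {set 'I_n}) :
  (\sum_(j < n) mem S' j * 2 ^ j = \sum_(j in S') 2 ^ j)%N.
  by rewrite [RHS]big_mkcond; apply: eq_bigr => j _;
     rewrite memE; case: (j \in S'); rewrite ?mul1n.
by rewrite !sumE.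
Qed.

(** * Determinants with diagonal entries ['X^(2 ^ i)] *)

Section DiagDet.

Variables (K : fieldType) (n : nat) (a : 'I_n -> 'I_n -> K).
Hypothesis char2 : 2%N \in [pchar K].

Definition powdiag_mx : 'M[{poly K}]_n :=
  \matrix_(i, j) if i == j then 'X^(2 ^ i) else (a i j)%:P.

(** Leibniz formula: the signs disappear in characteristic 2, and the fixed points of [s] supply the
    power of ['X]. *)
Lemma det_powdiag_mx :
  \det powdiag_mx =
    \sum_(s : 'S_n) (\prod_(i | s i != i) a i (s i)) *:
       'X^(\sum_(i in [set i | s i == i]) 2 ^ i).
Proof.
have m1 : -1 = 1 :> {poly K}.
  by rewrite -[RHS]polyC1 -(oppr_pchar2 char2 1) polyCN polyC1.
rewrite /determinant; apply: eq_bigr => s _.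
rewrite m1 expr1n mul1r (bigID (fun i => s i == i)) /= mulrC -mul_polyC.
congr (_ * _).
  rewrite rmorph_prod; apply: eq_bigr => i si.
  by rewrite mxE eq_sym (negPf si).
rewrite -prodrXr; apply: eq_big => [i|i si]; first by rewrite inE.
by rewrite mxE eq_sym si.
Qed.

Lemma coef_det_powdiag_mx (W : {set 'I_n}) :
    minset (sinkless (fun i j => (i != j) && (a i j != 0))) W ->
  (\det powdiag_mx)`_(\sum_(i in ~: W) 2 ^ i) != 0.
Proof.
case/minset_sinkless_out => h hW [hinj huniq].
(* The successor map of [W], extended by the identity, is the only permutation that contributes at
   this exponent. *)
pose g i := if i \in W then h i else i.
have gW i : (g i \in W) = (i \in W).
  by rewrite /g; case: ifP => // Wi; have /andP[] := hW i Wi.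
have g_inj : injective g.
  move=> i j eqg; have : (i \in W) = (j \in W) by rewrite -gW eqg gW.
  move: eqg; rewrite /g; case: ifP => Wi; case: ifP => // Wj.
  by move=> eqh _; apply: hinj.
pose s0 := perm g_inj.
have s0W : [set i | s0 i == i] = ~: W.
  apply/setP => i; rewrite !inE permE /g; case: ifP => Wi; last by rewrite eqxx.
  by have /and3P[_ /negPf] := hW i Wi; rewrite eq_sym.
rewrite det_powdiag_mx coef_sum (bigD1 s0) //= [X in _ + X]big1 ?addr0 => [|s ns].
  rewrite coefZ coefXn s0W eqxx mulr1; apply/prodf_neq0 => i s0i.
  have Wi : i \in W by move: s0i; rewrite permE /g; case: ifP; rewrite ?eqxx.
  by rewrite permE /g Wi; have /and3P[] := hW i Wi.
rewrite coefZ coefXn; have [sW|] := eqVneq; last by rewrite mulr0.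
have {}sW : ~: W = [set i | s i == i] by apply: sum_exp2_inj.
have sWE i : (s i == i) = (i \notin W) by rewrite -in_setC sW inE.
rewrite mulr1; apply/eqP; apply: contraNT ns => /prodf_neq0 nz.
apply/eqP/permP => i; rewrite permE /g; case: ifPn => Wi; last first.
  by apply/eqP; rewrite sWE.
have si : s i != i by rewrite sWE Wi.
apply: huniq => //; last by rewrite eq_sym si nz.
by rewrite -[_ \in _]negbK -sWE (inj_eq perm_inj).
Qed.

(** The identity gives the leading term; any other permutation loses [2 ^ i] from the exponent at
    each point [i] it moves. *)
Lemma det_powdiag_mx_monic :
  (\det powdiag_mx \is monic) /\ size (\det powdiag_mx) = (2 ^ n)%N.
Proof.
have sumT : (\sum_(i < n) 2 ^ i = (2 ^ n).-1)%N.
  by rewrite (predn_exp 2 n) mul1n.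
have P2n : (0 < 2 ^ n)%N by rewrite expn_gt0.
suff [R sR detE] : exists2 R : {poly K},
    (size R <= (2 ^ n).-1)%N & \det powdiag_mx = 'X^((2 ^ n).-1) + R.
  have sX : (size R < size ('X^((2 ^ n).-1) : {poly K}))%N.
    by rewrite size_polyXn.
  by rewrite detE monicE lead_coefDl // lead_coefXn size_polyDl // size_polyXn
             prednK.
rewrite det_powdiag_mx (bigD1 1%g) //= big_pred0 ?scale1r; last first.
  by move=> i; rewrite perm1 eqxx.
under [X in 'X^X + _]eq_bigl do rewrite inE perm1 eqxx.
rewrite sumT; eexists; last reflexivity.
apply: (leq_trans (size_sum _ _ _)); apply/bigmax_leqP => s ns.
apply: (leq_trans (size_scale_leq _ _)); rewrite size_polyXn -sumT.
have [i si] : exists i, s i != i.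
  apply/existsP; apply: contraNT ns; rewrite negb_exists => /forallP s1.
  by apply/eqP/permP => i; rewrite perm1; apply/eqP; move: (s1 i); rewrite negbK.
rewrite [X in (_ < X)%N](bigID (mem [set i | s i == i])) /= -addn1 leq_add2l.
by rewrite (bigD1 i) ?inE //= addn_gt0 expn_gt0.
Qed.

(** The exponent [2 ^ n - 2] would need a permutation moving the index 0 and nothing else. *)
Lemma coef_det_powdiag_mx_pred2 :
  (0 < n)%N -> (\det powdiag_mx)`_(2 ^ n - 2) = 0.
Proof.
move=> n0; pose i0 := Ordinal n0.
have -> : (2 ^ n - 2 = \sum_(i in [set~ i0]) 2 ^ i)%N.
  have := predn_exp 2 n; rewrite mul1n (bigD1 i0) //= expn0 -subn1 => eq2n.
  by rewrite (subnDA 1 _ 1) eq2n addKn; apply: eq_bigl => i; rewrite !inE.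
rewrite det_powdiag_mx coef_sum big1 // => s _; rewrite coefZ coefXn.
have [sS|] := eqVneq; last by rewrite mulr0.
have {}sS : [set~ i0] = [set i | s i == i] by apply: sum_exp2_inj.
have sE i : (s i == i) = (i != i0) by rewrite -in_setC1 sS inE.
have := sE i0; rewrite eqxx => /negbT s0; move: (sE (s i0)).
by rewrite (inj_eq perm_inj) s0 (negPf s0).
Qed.

End DiagDet.

(** * Linearized polynomials with injective quotient *)

Section TwoPolynomials.

Variables (K : finFieldType) (n : nat).
Hypothesis cardK : #|K| = (2 ^ n.+1)%N.

Lemma pchar_card_exp2 : 2%N \in [pchar K].
Proof.
have [p p_pr pK] := finPcharP K.
have Kp := card_pprimeChar pK; suff -> : 2%N = p by [].
have p2 : (p %| 2 ^ n.+1)%N.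
  rewrite -cardK [#|K|]Kp; apply: dvdn_exp => //; rewrite lt0n.
  by apply: contraTneq (finNzRing_gt1 K) => k0; rewrite [#|K|]Kp k0.
apply/eqP; rewrite eq_sym -dvdn_prime2 //.
by move: p2; rewrite Euclid_dvdX // => /andP[].
Qed.

Local Notation char2 := pchar_card_exp2.

Lemma exp2_natD k (x y : K) : (x + y) ^+ (2 ^ k) = x ^+ (2 ^ k) + y ^+ (2 ^ k).
Proof. by rewrite exprDn_pchar // pnatX (eq_pnat _ (pcharf_eq char2)). Qed.

Lemma exp2_nat_sum k (I : finType) (F : I -> K) :
  (\sum_i F i) ^+ (2 ^ k) = \sum_i F i ^+ (2 ^ k).
Proof.
apply: (big_morph (fun x : K => x ^+ (2 ^ k)) (exp2_natD k)).
by rewrite expr0n expn_eq0.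
Qed.

Lemma exp2_nat_mod k (x : K) : x ^+ (2 ^ (k %% n.+1)) = x ^+ (2 ^ k).
Proof.
rewrite [in RHS](divn_eq k n.+1); elim: (k %/ n.+1)%N => [|q IHq] //.
by rewrite mulSn -addnA expnD exprM -cardK expf_card.
Qed.

(** Raising to the power [2 ^ j] shifts the coefficients cyclically: indices subtract modulo [n.+1],
    as [x ^+ (2 ^ n.+1) = x]. *)
Lemma exp2_nat_linear (c : 'I_n.+1 -> K) (j : 'I_n.+1) x :
  \sum_i c (i - j) ^+ (2 ^ j) * x ^+ (2 ^ i) =
    (\sum_i c i * x ^+ (2 ^ i)) ^+ (2 ^ j).
Proof.
rewrite exp2_nat_sum [RHS](reindex_inj (addIr (- j))); apply: eq_bigr => i _.
rewrite exprMn; congr (_ * _).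
by rewrite -exprM -expnD -[in LHS](subrK j i) -[RHS]exp2_nat_mod.
Qed.

Lemma exp2_nat_fixed s (x : K) :
  coprime s n.+1 -> x ^+ (2 ^ s) = x -> x = 0 \/ x = 1.
Proof.
move=> co_s xs; have x2k k r : x ^+ (2 ^ r) = x -> x ^+ (2 ^ (k * r)) = x.
  move=> xr; elim: k => [|k IHk]; first by rewrite mul0n expr1.
  by rewrite mulSn expnD exprM xr.
have x2 : x ^+ 2 = x.
  (* Bezout, as [a * n.+1 = b * s + 1]: the Frobenius powers [n.+1] and [s] fix [x], hence so does
     squaring. *)
  case: (egcdnP s (ltn0Sn n)) => a b; rewrite gcdnC (eqP co_s) => ab _.
  have := x2k a _ (etrans (congr1 _ (esym cardK)) (expf_card x)).
  by rewrite ab expnD exprM x2k.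
have /eqP : x * (x - 1) = 0 by rewrite mulrBr mulr1 -expr2 x2 subrr.
by rewrite mulf_eq0 subr_eq0 => /orP[] /eqP; [left | right].
Qed.

Variable c : 'I_n.+1 -> K.
Let f x := \sum_i c i * x ^+ (2 ^ i).

Let a i j := c (i - j) ^+ (2 ^ j).

(** The row of the [x ^+ (2 ^ i)] lies in the left kernel at [f x / x]: entry [j] of the product is
    twice [f x ^+ (2 ^ j)], since [c 0 = 0] makes the missing diagonal term vanish. *)
Lemma root_det_powdiag_mx x :
  c 0 = 0 -> x != 0 -> root (\det (powdiag_mx a)) (f x / x).
Proof.
move=> c0 x0; set b := f x / x.
rewrite /root -[_.[b]]/(horner_eval b _) -det_map_mx; apply/det0P.
exists (\row_i x ^+ (2 ^ i)).
  apply/eqP => /rowP/(_ 0)/eqP; rewrite !mxE expf_eq0 (negPf x0) andbF //.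
apply/rowP => j; rewrite !mxE (bigD1 j) //= !mxE eqxx /horner_eval hornerXn.
rewrite -exprMn mulrC divfK // (eq_bigr (fun i => a i j * x ^+ (2 ^ i))).
  have := exp2_nat_linear c j x; rewrite (bigD1 j) //= subrr c0 expr0n expn_eq0.
  by rewrite mul0r add0r => ->; rewrite addrr_pchar2 ?char2.
by move=> i ij; rewrite !mxE (negPf ij) hornerC mulrC.
Qed.

Hypothesis n0 : (0 < n)%N.

Lemma linear_quotient_inj_monomial :
    c 0 = 0 -> {in [pred x | x != 0] &, injective (fun x => f x / x)} ->
  exists s : 'I_n.+1, [/\ coprime s n.+1, c s != 0 & forall i, i != s -> c i = 0].
Proof.
move=> c0 finj; pose P := \det (powdiag_mx a).
have [/= Pmon sP] := det_powdiag_mx_monic a char2.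
pose B := [seq f x / x | x : K in [pred x | x != 0]].
have uB : uniq B by apply/dinjectiveP.
have sB : size B = (2 ^ n.+1).-1.
  by rewrite size_image (cardC1 (0 : K)) cardK.
have PE : P = \prod_(b <- B) ('X - b%:P).
  rewrite [LHS](@all_roots_prod_XsubC _ _ B) ?uniq_rootsE //.
  - by rewrite (monicP Pmon) scale1r.
  - by rewrite sP sB prednK // expn_gt0.
  by apply/allP => _ /imageP[x x0 ->]; apply: root_det_powdiag_mx.
(* The [q - 1] quotients, where [q = #|K|], miss one element [z]; the factor ['X - z%:P] completes
   [P] to ['X^q - 'X]. *)
have [z zB] : exists z, z \notin B.
  apply/existsP; apply: contraT; rewrite negb_exists => /forallP allB.
  have : (#|K| <= size B)%N.
    rewrite -(card_uniqP uB); apply/subset_leq_card/subsetP => x _.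
    by have := allB x; rewrite negbK.
  by rewrite sB cardK leqNgt prednK ?expn_gt0 // leqnn.
have PzE : ('X - z%:P) * P = 'X^(2 ^ n.+1) - 'X.
  rewrite PE -(big_cons _ _ z B xpredT (fun b => 'X - b%:P)) -cardK finField_genPoly.
  rewrite -[RHS]big_enum; apply: perm_big; apply: uniq_perm; rewrite ?enum_uniq //=.
    by rewrite zB.
  apply: (uniq_min_size _ _ _).2; rewrite /= ?zB //.
    by move=> x _; rewrite mem_enum.
  by rewrite -cardE cardK sB prednK // expn_gt0.
have e2 : (2 ^ n.+1 = (2 ^ n.+1 - 2).+2)%N.
  by rewrite -[RHS]addn2 subnK // expnS leq_pmulr // expn_gt0.
have e4 : (0 < 2 ^ n.+1 - 2)%N.
  by rewrite subn_gt0 -[X in (X < _)%N](expn1 2) ltn_exp2l.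
(* Compare coefficients of degree [q - 1]: that of degree [q - 2] in [P] is zero, so [- z] must
   vanish. *)
have z0 : z = 0.
  have := congr1 (fun p : {poly K} => p`_(2 ^ n.+1 - 2).+1) PzE.
  rewrite mulrBl !coefB coefXM coefCM coefX coefXn /= (coef_det_powdiag_mx_pred2 a char2) //.
  rewrite [X in (_ == X)%N]e2 eqSS eqn_leq ltnn andbF eqSS (gtn_eqF e4) subrr sub0r.
  have := monicP Pmon; rewrite /lead_coef sP [in X in X -> _]e2 /= => ->.
  by rewrite mulr1 => /eqP; rewrite oppr_eq0 => /eqP.
have PXE k : P`_k = (k.+1 == 2 ^ n.+1)%N%:R - (k == 0)%N%:R.
  have := congr1 (fun p : {poly K} => p`_k.+1) PzE.
  by rewrite z0 subr0 coefXM /= coefB coefXn coefX.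
pose e i j := (i != j) && (a i j != 0).
have eE i j : e i j = (c (i - j) != 0).
  rewrite /e /a expf_eq0 expn_gt0 /= andb_idl //.
  by apply: contraNneq => ->; rewrite subrr c0.
(* If all coefficients vanished, every quotient would be 0, against injectivity, since [K] has more
   than two elements. A nonzero [c t] gives each [i] the successor [i - t]. *)
have sT : sinkless e setT.
  have [t ct] : exists t, c t != 0.
    apply/existsP; apply: contraT; rewrite negb_exists => /forallP c_eq0.
    have f0 x : f x / x = 0.
      rewrite /f big1 ?mul0r // => i _.
      by have := c_eq0 i; rewrite negbK => /eqP->; rewrite mul0r.
    have /subsetPn[x _] : ~~ ([set: K] \subset [set 0; 1]).
      apply/negP => /subset_leq_card; rewrite cardsT cardK cards2 leqNgt.
      rewrite eq_sym oner_eq0 -[X in (X < _)%N](expn1 2) ltn_exp2l // ltnS n0.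
      by [].
    rewrite !inE negb_or => /andP[x0 x1]; case/eqP: x1.
    by apply: finj; rewrite ?inE ?oner_eq0 // !f0.
  apply/andP; split; first by apply/set0Pn; exists 0; rewrite inE.
  apply/'forall_implyP => i _; apply/'exists_andP; exists (i - t).
  by rewrite inE eE subKr.
have [W Wmin _] := minset_exists sT.
(* Only the exponents [q - 1] and 0 occur in [P]; the first would make [W] empty. *)
have WT : W = setT.
  have := coef_det_powdiag_mx char2 Wmin; rewrite -/P PXE.
  have W0 : W != set0 by have /minsetP[/andP[]] := Wmin.
  have sumT : (\sum_(i < n.+1) 2 ^ i = (2 ^ n.+1).-1)%N.
    by rewrite (predn_exp 2 n.+1) mul1n.
  have [|_] := eqVneq (\sum_(i in ~: W) 2 ^ i).+1 (2 ^ n.+1)%N.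
    move=> /(congr1 predn) /=; rewrite -sumT => eqs _; exfalso; case/negP: W0.
    rewrite -[W]setCK -setCT; apply/eqP; congr (~: _); apply: sum_exp2_inj.
    by rewrite /= eqs; apply: eq_bigl => i; rewrite inE.
  rewrite sub0r oppr_eq0.
  have [/eqP|_] := eqVneq (\sum_(i in ~: W) 2 ^ i)%N 0%N; last by rewrite eqxx.
  rewrite sum_nat_eq0 => /forall_inP Wc _.
  apply/setP => i; rewrite !inE; apply: contraT => Wi.
  by have := Wc i; rewrite inE Wi expn_eq0 => /(_ isT).
rewrite {}WT in Wmin.
have [h hT [_ huniq]] := minset_sinkless_out Wmin.
have hE i j : c (i - j) != 0 -> j = h i.
  by move=> cij; apply: huniq; rewrite ?inE //; rewrite -eE in cij.
have [|_ e0] := andP (hT 0 _); first by rewrite inE.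
rewrite -/(e _ _) eE sub0r in e0.
exists (- h 0); split=> // [|i]; last first.
  apply: contra_neq_eq => ci; rewrite -(hE 0 (- i)) ?opprK //.
  by rewrite add0r.
move: (- h 0) e0 => s e0.
(* Multiples of the gcd are stable under [i - s], hence form a sinkless set; by minimality they
   include 1, so the gcd is 1. *)
pose D := [set i : 'I_n.+1 | (gcdn s n.+1 %| i)%N].
have : D = setT.
  have /minsetP[_ minT] := Wmin; apply: minT; last exact: subsetT.
  apply/andP; split; first by apply/set0Pn; exists 0; rewrite inE dvdn0.
  apply/'forall_implyP => i Di; apply/'exists_andP; exists (i - s).
  rewrite -/(e _ _) eE subKr e0; split=> //; move: Di; rewrite !inE => di.
  have dn := dvdn_gcdr s n.+1; have ds := dvdn_gcdl s n.+1.
  have dmod k : (gcdn s n.+1 %| k %% n.+1)%N = (gcdn s n.+1 %| k)%N.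
    by rewrite /dvdn modn_dvdm.
  by rewrite /= dmod dvdn_addr // dmod dvdn_subr // ltnW.
move/setP/(_ (inord 1)); rewrite !inE inordK // dvdn1; exact.
Qed.
End TwoPolynomials.

(** * Counting MRD codes *)

Lemma card_unitmx_GL (F : finFieldType) d :
  (0 < d)%N -> #|[set M : 'M[F]_d | M \in unitmx]| = #|'GL_d[F]%g|.
Proof.
case: d => // d _.
rewrite cardsT -(card_imset _ (val_inj : injective (@GLval d.+1 F))).
apply: eq_card => M; rewrite inE; apply/idP/imsetP => [uM|[u _ ->]].
  exists (insubd (1%g : {'GL_d.+1[F]}) M) => //.
  by rewrite -[GLval _]/(val _) insubdK.
exact: (valP u).
Qed.

Section BinaryCodes.

Variables (L : fieldExtType 'F_2) (n : nat).
Hypothesis n0 : (0 < n)%N.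
Hypothesis dimL : \dim {:L} = n.+1.

(** [L] with the finite structure needed for counting. *)
Local Notation K := (finvect_type L).
Local Notation row := 'rV[K]_n.+1.
Local Notation ev := (@lin_eval _ K n.+1).
Local Notation q := (2 ^ n.+1)%N.
Implicit Types (f g : row) (C : {vspace row}).

(** * Evaluation and zeros of linearized polynomials *)

Lemma card_finvect : #|K| = q.
Proof.
have <- : #|(fullv : {vspace K})| = #|K| by apply: eq_card => x; rewrite !memvf.
by rewrite card_vspace card_Fp // dimL.
Qed.

Lemma evE f x : ev f x = \sum_i f 0 i * x ^+ (2 ^ i).
Proof. by rewrite lin_evalE card_Fp. Qed.

Lemma evD f g x : ev (f + g) x = ev f x + ev g x.
Proof. by rewrite !evE -big_split; apply: eq_bigr => i _; rewrite mxE mulrDl. Qed.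

Lemma evZ k f x : ev (k *: f) x = k * ev f x.
Proof. by rewrite !evE mulr_sumr; apply: eq_bigr => i _; rewrite mxE mulrA. Qed.

Lemma ev0 f : ev f 0 = 0. Proof. exact: linear0. Qed.

(** The degree is at most [2 ^ n], too small for [q] roots. *)
Lemma ev_eq0 f : ev f =1 (fun=> 0) -> f = 0.
Proof.
move=> f0; have p0 : linpoly f = 0.
  apply: (@roots_geq_poly_eq0 _ _ (enum K)); rewrite ?enum_uniq //.
    by apply/allP => x _; apply/rootP; apply: f0.
  rewrite -cardE card_finvect; apply: leq_trans (size_sum _ _ _) _.
  apply/bigmax_leqP => i _; apply: leq_trans (size_scale_leq _ _) _.
  by rewrite size_polyXn card_Fp // ltn_exp2l.
apply/rowP => i; have := congr1 (fun p : {poly K} => p`_(2 ^ i)) p0.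
rewrite coef0 coef_sum (bigD1 i) //= coefZ card_Fp // coefXn eqxx mulr1 mxE.
rewrite big1 ?addr0 // => j ji; rewrite coefZ coefXn eqn_exp2l //.
by rewrite eq_sym [(j == i :> nat)](negPf ji) mulr0.
Qed.

Lemma ev_inj f g : ev f =1 ev g -> f = g.
Proof.
move=> fg; apply/eqP; rewrite -subr_eq0; apply/eqP/ev_eq0 => x.
by rewrite -scaleN1r evD evZ fg mulN1r subrr.
Qed.

Definition zeros f := [set x | ev f x == 0].

Lemma mem0_zeros f : 0 \in zeros f. Proof. by rewrite inE ev0. Qed.

Lemma card_zerosE f : #|zeros f| = (2 ^ \dim (lker (linfun (ev f))))%N.
Proof.
have -> : #|zeros f| = #|lker (linfun (ev f))|.
  by apply: eq_card => x; rewrite inE memv_ker lfunE.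
by rewrite card_vspace card_Fp.
Qed.

Lemma card_zeros f :
  (lin_rank f <= n.+1)%N /\ #|zeros f| = (2 ^ (n.+1 - lin_rank f))%N.
Proof.
have := limg_ker_dim (linfun (ev f)) fullv; rewrite capfv dimL -/(lin_rank f) => dimE.
split; first exact: leq_trans (leq_addl _ _) (eq_leq dimE).
by rewrite -(canRL (addnK _) dimE) card_zerosE.
Qed.

Lemma card_zeros0 : #|zeros 0| = q.
Proof.
rewrite -card_finvect -cardsT; apply: eq_card => x.
by rewrite !inE evE big1 ?eqxx // => i _; rewrite mxE mul0r.
Qed.

(** * Codes whose nonzero elements have at most two zeros *)

Lemma q_gt2 : (2 < q)%N.
Proof. by rewrite -[X in (X < _)%N](expn1 2) ltn_exp2l // ltnS n0. Qed.

(** In dimension two this is the MRD condition: rank at least [n] means a kernel of dimension at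
    most one over ['F_2]. *)
Definition scattered C := forall f, f \in C -> f != 0 -> (#|zeros f| <= 2)%N.

Lemma zeros_card3 f x y :
  x != 0 -> y != 0 -> x != y -> ev f x = 0 -> ev f y = 0 -> (2 < #|zeros f|)%N.
Proof.
move=> x0 y0 xy fx fy; have -> : 3%N = #|[set x; y; 0]|.
  by rewrite setUC cardsU1 cards2 xy !inE !(eq_sym 0) (negPf x0) (negPf y0).
apply/subset_leq_card/subsetP => z; rewrite !inE.
by case/orP => [/orP[]|] /eqP ->; rewrite ?fx ?fy ?ev0.
Qed.

Definition ev_at x : 'Hom(row, K^o) := linfun (fun f => ev f x : K^o).

Lemma ev_atE x f : ev_at x f = ev f x.
Proof.
rewrite /ev_at; pose e := fun f => ev f x : K^o.
have lin_e : linear e by move=> k g h; rewrite /e evD evZ.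
pose eL := GRing.isLinear.Build _ _ _ _ e lin_e.
pose E : {linear row -> K^o} := HB.pack e eL.
by rewrite -[LHS]/(linfun E f) lfunE.
Qed.

(* Evaluation at [x] is not identically zero on [C]: else a nonzero element
   vanishing at a further point would have four zeros. *)
Lemma card_vanishing C x : \dim C = 2 -> scattered C -> x != 0 ->
  #|[set f in C | ev f x == 0]| = #|K|.
Proof.
move=> dimC scC x0.
have -> : #|[set f in C | ev f x == 0]| = #|(C :&: lker (ev_at x))%VS|.
  by apply: eq_card => f; rewrite inE memv_cap memv_ker ev_atE.
have le1 y : (\dim (ev_at y @: C) <= 1)%N.
  by rewrite (leq_trans (dimvS (subvf _))) // dimvf.
have kdim y : (\dim (C :&: lker (ev_at y)) + \dim (ev_at y @: C) = 2)%N.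
  by rewrite limg_ker_dim.
suff im1 : \dim (ev_at x @: C) = 1%N.
  rewrite card_vspace (_ : \dim _ = 1%N) ?expn1 //.
  by have := kdim x; rewrite im1 addn1 => -[].
apply/eqP; rewrite eqn_leq le1 lt0n dimv_eq0; apply/negP => /eqP im0.
have Cx f : f \in C -> ev f x = 0.
  move=> Cf; have : ev_at x f \in (ev_at x @: C)%VS by apply: memv_img.
  by rewrite im0 memv0 ev_atE => /eqP.
have [y y0 yx] : exists2 y : K, y != 0 & x != y.
  have /subsetPn[y _] : ~~ ([set: K] \subset [set 0; x]).
    apply/negP => /subset_leq_card; rewrite cardsT card_finvect cards2 eq_sym x0.
    by rewrite leqNgt -[X in (X < _)%N](expn1 2) ltn_exp2l // ltnS n0.
  by rewrite !inE negb_or => /andP[y0 yx]; exists y; rewrite // eq_sym.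
have [f /memv_capP [Cf]] : exists2 f, f \in (C :&: lker (ev_at y))%VS & f != 0.
  exists (vpick (C :&: lker (ev_at y))); first exact: memv_pick.
  rewrite vpick0 -dimv_eq0; apply/eqP => k0.
  by have := kdim y; rewrite k0 add0n => im2; have := le1 y; rewrite im2.
rewrite memv_ker ev_atE => /eqP fy f0.
by have := scC f Cf f0; rewrite leqNgt (zeros_card3 x0 y0) // Cx.
Qed.

Definition invertible f := #|zeros f| == 1%N.

Lemma card_invertible_in C : \dim C = 2 -> scattered C ->
  #|[set f in C | invertible f]| = (2 * q.-1)%N.
Proof.
move=> dimC scC; have q2 : (1 < q)%N by rewrite -[1%N](expn0 2) ltn_exp2l.
pose D := [set f in C | f != 0].
have cardD : #|D| = (q ^ 2).-1.
  have cardC : #|C| = (q ^ 2)%N by rewrite card_vspace dimC card_finvect.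
  rewrite -cardC (cardD1 0 C) mem0v; apply: eq_card => f.
  by rewrite !inE andbC.
(* Count pairs of a nonzero [f] in [C] and a nonzero zero of it; each non-invertible [f] occurs in
   exactly one pair. *)
have : (\sum_(f in D) (#|zeros f|.-1) = q.-1 * q.-1)%N.
  transitivity (\sum_(f in D) \sum_(x in [set~ 0%R] | ev f x == 0%R) 1)%N.
    apply: eq_bigr => f _; rewrite sum1_card (cardD1 0 (zeros f)) mem0_zeros /=.
    by rewrite add0n; apply: eq_card => x; rewrite [RHS]unfold_in !inE.
  rewrite (exchange_big_dep (mem [set~ 0])) /= => [|f x _ /andP[]] //.
  rewrite (eq_bigr (fun=> q.-1)) => [|x].
    by rewrite sum_nat_const cardsC1 card_finvect.
  rewrite !inE => x0; rewrite sum1_card -card_finvect -(card_vanishing dimC scC x0).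
  rewrite [in RHS](cardD1 0 [set f in C | _]) inE mem0v evE.
  rewrite big1 ?eqxx => [/=|i _]; last by rewrite mxE mul0r.
  rewrite add0n; apply: eq_card => f.
  by rewrite [LHS]unfold_in !inE x0 -andbA andbCA.
rewrite (bigID invertible) /= big1 => [|f /andP[_ /eqP ->]] //.
rewrite add0n (eq_bigr (fun=> 1%N)) => [|f /andP[]]; last first.
  rewrite inE => /andP[Cf f0]; have := scC f Cf f0.
  have : (0 < #|zeros f|)%N by apply/card_gt0P; exists 0; apply: mem0_zeros.
  by rewrite /invertible; case: #|_| => [|[|[|]]].
rewrite sum1_card => cardN; have := cardsID [set f | invertible f] D.
rewrite cardD (_ : #|D :\: _| = (q.-1 * q.-1)%N); last first.
  by rewrite -cardN; apply: eq_card => f; rewrite [RHS]unfold_in !inE andbC.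
rewrite (_ : D :&: _ = [set f in C | invertible f]); last first.
  apply/setP => f; rewrite !inE -andbA; case: (f \in C) => //=.
  apply: andb_idl; apply: contraTneq => ->; rewrite /invertible.
  by rewrite card_zeros0 gtn_eqF.
have -> p : (0 < p -> (p ^ 2).-1 = 2 * p.-1 + p.-1 * p.-1)%N.
  by case: p => // p _; rewrite -mulnn mulSn mulnS /= mul2n -addnn addnA.
  by move/addIn.
exact: ltnW.
Qed.

(** * Linearized polynomials as all endomorphisms over ['F_2] *)

Let e := vbasis {:K}.
Let e_basis : basis_of {:K} e := vbasisP {:K}.

Definition ev_mx f := mxof e e (linfun (ev f)).

Lemma ev_mx_inj : injective ev_mx.
Proof.
move=> f g /(can_inj (mxofK e_basis e_basis)) /lfunP fg.
by apply: ev_inj => x; have := fg x; rewrite !lfunE.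
Qed.

(** Both sides have [q ^ n.+1] elements, so injectivity suffices. *)
Lemma ev_mx_onto M : exists f, ev_mx f = M.
Proof.
have /(_ M) : forall M, M \in codom ev_mx.
  apply: inj_card_onto ev_mx_inj _.
  by rewrite !card_mx card_finvect card_Fp // mul1n [\dim _]dimL expnM.
by case/codomP => f ->; exists f.
Qed.

Lemma ev_onto (phi : 'End(K)) : exists f, ev f =1 phi.
Proof.
have [f /(can_inj (mxofK e_basis e_basis)) fphi] := ev_mx_onto (mxof e e phi).
by exists f => x; rewrite -fphi lfunE.
Qed.

Lemma invertibleE f : invertible f = (lker (linfun (ev f)) == 0%VS).
Proof.
rewrite /invertible card_zerosE -dimv_eq0.
by case: (\dim _) => // d; rewrite expnS mul2n;
  case: (2 ^ d)%N (expn_gt0 2 d) => [|[]].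
Qed.

Lemma invertible_mx f : invertible f = (ev_mx f \in unitmx).
Proof.
rewrite invertibleE (lker_ker e_basis) (vsof_eq0 e_basis) kermx_eq0.
exact: row_free_unit.
Qed.

Lemma card_invertible : #|[set f | invertible f]| = #|'GL_n.+1(2)%g|.
Proof.
rewrite -(card_imset _ ev_mx_inj).
transitivity #|[set M : 'M['F_2]_(\dim {:K}) | M \in unitmx]|.
  apply: eq_card => M; rewrite inE; apply/imsetP/idP => [[f]|].
    by rewrite inE invertible_mx => + ->.
  by have [f <-] := ev_mx_onto M; exists f; rewrite ?inE ?invertible_mx.
rewrite (card_unitmx_GL 'F_2); last by rewrite [\dim _]dimL.
by rewrite [\dim _]dimL.
Qed.

(** * Codes spanned by an invertible element and a Frobenius power of it *)

Implicit Types (s t : 'I_n.+1).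

(** The power [f ^ (2 ^ s)], reduced modulo [x ^ q - x]. *)
Definition frob f (s : 'I_n.+1) : row := \row_i f 0 (i - s) ^+ (2 ^ s).

Lemma ev_frob f s x : ev (frob f s) x = ev f x ^+ (2 ^ s).
Proof.
rewrite !evE -(exp2_nat_linear card_finvect (f 0)).
by apply: eq_bigr => i _; rewrite mxE.
Qed.

Definition frob_code f s : {vspace row} := <<[:: f; frob f s]>>%VS.

Lemma frob_codeP f s g :
  reflect (exists a b, g = a *: f + b *: frob f s) (g \in frob_code f s).
Proof.
rewrite /frob_code span_cons span_seq1; apply: (iffP memv_addP).
  by move=> [_ /vlineP[a ->] [_ /vlineP[b ->] ->]]; exists a, b.
move=> [a [b ->]]; exists (a *: f); first exact: memvZ (memv_line _).
by exists (b *: frob f s); first exact: memvZ (memv_line _).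
Qed.

Lemma invertible_eq0 f x : invertible f -> ev f x = 0 -> x = 0.
Proof.
rewrite invertibleE => /eqP ker0 fx; apply/eqP.
by rewrite -memv0 -ker0 memv_ker lfunE; apply/eqP.
Qed.

Lemma invertible_inj f : invertible f -> injective (ev f).
Proof. by rewrite invertibleE => /lker0P inj x y xy; apply: inj; rewrite !lfunE. Qed.

(** Two nonzero zeros give nonzero values [u], [v] of [f] whose ratio is fixed by the power [2 ^ s];
    the ratio is then 1, and [f] is injective. *)
Lemma zeros_frob_comb f s a b : invertible f -> coprime s n.+1 ->
  (a != 0) || (b != 0) -> (#|zeros (a *: f + b *: frob f s)| <= 2)%N.
Proof.
move=> inv_f co_s ab0; rewrite leqNgt; apply/negP => gt2; set h := _ + _ in gt2.
have /card_gt1P[x [y []]] : (1 < #|zeros h :\ 0%R|)%N.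
  by move: gt2; rewrite (cardsD1 0) mem0_zeros.
have hE z : ev h z = a * ev f z + b * ev f z ^+ (2 ^ s).
  by rewrite evD !evZ ev_frob.
rewrite !inE !hE => /andP[x0 /eqP hx] /andP[y0 /eqP hy] /negP[]; apply/eqP.
apply: (invertible_inj inv_f); move: hx hy.
have : ev f x != 0 by apply: contraNneq x0 => /(invertible_eq0 inv_f) ->.
have : ev f y != 0 by apply: contraNneq y0 => /(invertible_eq0 inv_f) ->.
move: (ev f x) (ev f y) => u v v0 u0 hu hv.
have b0 : b != 0.
  move: ab0; case: (eqVneq b 0) hu => [-> /eqP|//].
  by rewrite mul0r addr0 mulf_eq0 (negPf u0) orbF => ->.
have w : (u / v) ^+ (2 ^ s) = u / v.
  have au : a * u = - (b * u ^+ (2 ^ s)) by apply/eqP; rewrite -addr_eq0 hu.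
  have av : a * v = - (b * v ^+ (2 ^ s)) by apply/eqP; rewrite -addr_eq0 hv.
  rewrite expr_div_n; apply/eqP; rewrite eqr_div ?expf_neq0 //.
  apply/eqP/(mulfI b0)/oppr_inj; rewrite mulrA -mulNr -au.
  by rewrite [u * _]mulrC mulrA -mulNr -av mulrAC.
have [|] := exp2_nat_fixed card_finvect co_s w; last by apply: divr1_eq.
by move/eqP; rewrite mulf_eq0 invr_eq0 (negPf u0) (negPf v0).
Qed.

Lemma frob_code_MRD f s : invertible f -> coprime s n.+1 ->
  \dim (frob_code f s) = 2 /\ scattered (frob_code f s).
Proof.
move=> inv_f co_s; split=> [|_ /frob_codeP[a [b ->]] ab]; last first.
  apply: zeros_frob_comb => //; apply: contraNT ab.
  by rewrite negb_or !negbK => /andP[/eqP-> /eqP->]; rewrite !scale0r addr0.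
(* The zero polynomial has [q > 2] zeros, so the bound on zeros already gives independence. *)
have comb_neq0 a b : (a != 0) || (b != 0) -> a *: f + b *: frob f s != 0.
  move=> /(zeros_frob_comb inv_f co_s); apply: contraTneq => ->.
  by rewrite card_zeros0 -ltnNge q_gt2.
have : free [:: f; frob f s].
  rewrite free_cons seq1_free span_seq1; apply/andP; split.
    apply/negP => /vlineP[k fk]; have := comb_neq0 1 (- k).
    by rewrite scale1r scaleNr -fk subrr oner_eq0 eqxx => /(_ isT).
  by have := comb_neq0 0 1; rewrite scale0r add0r scale1r oner_eq0 orbT => ->.
by move/eqnP.
Qed.

Lemma ev_delta (s : 'I_n.+1) x : ev (delta_mx 0 s) x = x ^+ (2 ^ s).
Proof.
rewrite evE (bigD1 s) //= !mxE !eqxx mul1r big1 ?addr0 // => i is_.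
by rewrite mxE (negPf is_) andbF mul0r.
Qed.

Lemma ev_comp_inv f g : invertible f -> exists h, forall x, ev h (ev f x) = ev g x.
Proof.
move=> inv_f; pose F := linfun (ev f).
have [h hE] := ev_onto (linfun (ev g) \o F^-1)%VF; exists h => x.
rewrite hE comp_lfunE -[ev f x](lfunE (ev f)) lker0_lfunK ?lfunE //.
by rewrite -invertibleE.
Qed.

Lemma invertible_onto f y : invertible f -> exists x, ev f x = y.
Proof.
move=> /invertible_inj inj; have : y \in codom (ev f).
  exact: inj_card_onto inj (leqnn _) y.
by case/codomP => x ->; exists x.
Qed.

(** As [f] is onto, it cancels, leaving [x ^ (2 ^ s)] as a combination of [x] and [x ^ (2 ^ t)];
    compare coefficients at [s], which is nonzero. *)
Lemma frob_code_inj f (s t : 'I_n.+1) : invertible f -> coprime s n.+1 ->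
  frob_code f s = frob_code f t -> s = t.
Proof.
move=> inv_f co_s st; have : frob f s \in frob_code f t.
  by rewrite -st; apply/frob_codeP; exists 0, 1; rewrite scale0r scale1r add0r.
case/frob_codeP => a [b fs].
have : delta_mx 0 s = a *: delta_mx 0 0 + b *: delta_mx 0 t :> row.
  apply: ev_inj => y; have [x <-] := invertible_onto y inv_f.
  have := congr1 (fun h => ev h x) fs.
  by rewrite /= !evD !evZ !ev_frob !ev_delta expr1.
move/rowP/(_ s); rewrite !mxE !eqxx /=.
have s0 : s != 0.
  apply: contraTneq co_s => ->; rewrite /coprime gcd0n; case: n n0 => //.
rewrite (negPf s0) mulr0 add0r; case: eqVneq => // _ /eqP.
by rewrite mulr0 oner_eq0.
Qed.

Lemma scattered_frob_code C f :
    \dim C = 2 -> scattered C -> f \in C -> invertible f ->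
  exists2 s : 'I_n.+1, coprime s n.+1 & C = frob_code f s.
Proof.
move=> dimC scC Cf inv_f.
have [g Cg gf] : exists2 g, g \in C & g \notin <[f]>%VS.
  apply/subvPn; apply/negP => /dimvS; rewrite dimC dim_vline.
  by case: (f != 0).
have [h hE] := ev_comp_inv g inv_f.
(* Here [h] is [g] composed with the inverse of [f]; dropping its linear term shifts all quotients
   by the constant [h 0 0]. *)
pose c i := if i == 0 then 0 else h 0 i.
have hcE y : ev h y = h 0 0 * y + \sum_i c i * y ^+ (2 ^ i).
  rewrite evE (bigD1 0) //= expr1 [in RHS](bigD1 0) //= {1}/c eqxx mul0r add0r.
  by congr (_ + _); apply: eq_bigr => i i0; rewrite /c (negPf i0).
have [|x y x0 y0 xy|s [co_s cs0 cs]] :=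
    @linear_quotient_inj_monomial K n card_finvect c n0.
- by rewrite /c eqxx.
(* The common quotient of [h] at [x] and [y]: [g - b *: f] vanishes at their preimages under [f],
   too many zeros if these differ. *)
- pose b := h 0 0 + (\sum_i c i * x ^+ (2 ^ i)) / x.
  have hb z : z != 0 -> h 0 0 + (\sum_i c i * z ^+ (2 ^ i)) / z = b ->
      ev h z = b * z.
    by move=> z0 <-; rewrite hcE mulrDl divfK.
  have [x' xE] := invertible_onto x inv_f.
  have [y' yE] := invertible_onto y inv_f.
  have gb0 : g - b *: f != 0.
    apply: contraNneq gf => /eqP; rewrite subr_eq0 => /eqP ->.
    by rewrite memvZ ?memv_line.
  have gbC : g - b *: f \in C by rewrite memvB ?memvZ.
  have gbE z : ev (g - b *: f) z = ev h (ev f z) - b * ev f z.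
    by rewrite -scaleNr evD evZ hE mulNr.
  case: (eqVneq x' y') => [x'y'|x'y']; first by rewrite -xE x'y'.
  have := scC _ gbC gb0; rewrite leqNgt (@zeros_card3 _ x' y') //.
  + by apply: contraNneq x0 => x'0; rewrite -xE x'0 ev0.
  + by apply: contraNneq y0 => y'0; rewrite -yE y'0 ev0.
  + by rewrite gbE xE hb // subrr.
  + by rewrite gbE yE hb ?subrr // /b xy.
exists s => //.
have gE : g = h 0 0 *: f + c s *: frob f s.
  apply: ev_inj => x; rewrite -hE hcE evD !evZ ev_frob (bigD1 s) //= big1 ?addr0 //.
  by move=> i is_; rewrite cs // mul0r.
apply/esym/eqP; rewrite eqEdim dimC (frob_code_MRD inv_f co_s).1 leqnn andbT.
have fC : frob f s \in C.
  rewrite -(scalerK cs0 (frob f s)) memvZ //.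
  by rewrite -[c s *: _](addKr (h 0 0 *: f)) -gE addrC memvB ?memvZ.
by apply/subvP => _ /frob_codeP[a [b ->]]; rewrite memvD ?memvZ.
Qed.

Lemma MRD_scattered C : is_MRD 2 C <-> \dim C = 2 /\ scattered C.
Proof.
have rankE f : (n <= lin_rank f)%N = (#|zeros f| <= 2)%N.
  have [le_r ->] := card_zeros f.
  have -> k : (2 ^ k <= 2)%N = (k <= 1)%N by apply: (leq_exp2l k 1).
  by rewrite leq_subLR addn1 ltnS.
have mE : (n.+1 - 2 + 1 = n)%N by rewrite subSS addn1 subn1 prednK.
split=> [[_ dimC [_ ge_r]]|[dimC scC]].
  by split=> // f Cf f0; have := ge_r f Cf f0; rewrite mE rankE.
rewrite /is_MRD mE; split=> //; first by rewrite -dimv_eq0 dimC.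
split=> [|f Cf f0]; last by rewrite rankE scC.
(* The minimum rank must be attained: a nonzero element of [C] vanishing at 1 is not invertible, so
   its rank is exactly [n]. *)
have /card_gt1P[f [g [/= Df Dg fg]]] : (1 < #|[set f in C | ev f 1%R == 0%R]|)%N.
  rewrite (card_vanishing dimC scC (oner_neq0 K)) card_finvect.
  exact: ltnW q_gt2.
have [h Dh h0] : exists2 h, h \in [set f in C | ev f 1 == 0] & h != 0.
  by case: (eqVneq f 0) fg => [-> g0|f0 _]; [exists g; rewrite // eq_sym | exists f].
move: Dh; rewrite inE => /andP[Ch /eqP h1]; exists h; split=> //.
apply/eqP; rewrite eqn_leq rankE scC // andbT.
have [le_r hz] := card_zeros h; rewrite -ltnS ltn_neqAle le_r andbT.
apply/eqP => rE; move: hz; rewrite rE subnn => /eqP; rewrite -/(invertible h).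
by move=> /invertible_eq0 /(_ h1) /eqP; rewrite oner_eq0.
Qed.

(** * Enumeration and double counting of the codes *)

Definition scatteredb C :=
  [forall f, (f \in C) && (f != 0) ==> (#|zeros f| <= 2)%N].

Lemma scatteredP C : reflect (scattered C) (scatteredb C).
Proof.
apply: (iffP forallP) => scC f.
  by move=> Cf f0; have := scC f; rewrite Cf f0.
by apply/implyP => /andP[]; apply: scC.
Qed.

(** Pairs of rows form a finite type and span every space of dimension two; [undup] keeps each span
    once. *)
Definition MRD_codes : seq {vspace row} :=
  [seq C <- undup [seq <<val X>>%VS | X : 2.-tuple row]
     | (\dim C == 2) && scatteredb C].

Lemma mem_MRD_codes C : (C \in MRD_codes) = (\dim C == 2) && scatteredb C.
Proof.
rewrite mem_filter andb_idr // => /andP[/eqP dimC _].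
rewrite mem_undup; have defC := span_basis (vbasisP C).
apply/imageP; exists (tcast dimC (vbasis C)) => //.
by rewrite /= val_tcast defC.
Qed.

Lemma MRD_codesP C : C \in MRD_codes <-> is_MRD 2 C.
Proof.
apply: iff_trans (iff_sym (MRD_scattered C)); rewrite mem_MRD_codes.
split=> [/andP[/eqP ? /scatteredP ?]|[-> scC]] //.
by rewrite eqxx; apply/scatteredP.
Qed.

Lemma count_MRD_codes f : invertible f ->
  count (fun C => f \in C) MRD_codes = totient n.+1.
Proof.
move=> inv_f.
pose S :=
  [seq frob_code f s | s : 'I_n.+1 in [pred s : 'I_n.+1 | coprime s n.+1]].
rewrite -size_filter.
have Suniq : uniq S.
  by apply/dinjectiveP => s t co_s _; apply: frob_code_inj.
rewrite -(_ : size S = size _); last first.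
  apply/perm_size/uniq_perm => // [|C].
    by rewrite filter_uniq // filter_uniq // undup_uniq.
  rewrite mem_filter mem_MRD_codes; apply/imageP/idP => [[s co_s ->]|].
    have [dimC scC] := frob_code_MRD inv_f co_s.
    rewrite dimC eqxx; apply/andP; split; last exact/scatteredP.
    by apply/frob_codeP; exists 1, 0; rewrite scale0r scale1r addr0.
  case/and3P => Cf /eqP dimC /scatteredP scC.
  by have [s co_s ->] := scattered_frob_code dimC scC Cf inv_f; exists s.
rewrite size_image totient_count_coprime big_mkord -sum1_card big_mkcond.
by apply: eq_bigr => s _; rewrite inE coprime_sym; case: coprime.
Qed.

Lemma size_MRD_codes :
  (size MRD_codes * (2 * q.-1) = #|'GL_n.+1(2)%g| * totient n.+1)%N.
Proof.
transitivity (\sum_(C <- MRD_codes) \sum_(f | invertible f && (f \in C)) 1)%N.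
  rewrite -sum1_size big_distrl /= big_seq [RHS]big_seq; apply: eq_bigr => C.
  rewrite mem_MRD_codes => /andP[/eqP dimC /scatteredP scC]; rewrite mul1n.
  rewrite -(card_invertible_in dimC scC) sum1_card; apply: eq_card => f.
  by rewrite inE [RHS]unfold_in andbC.
(* Sum over invertible elements first: each lies in [totient n.+1] codes. *)
rewrite (exchange_big_dep invertible) => [|C f _ /andP[]] //=.
rewrite -card_invertible -sum_nat_const; apply: eq_big => [f|f inv_f].
  by rewrite inE.
by rewrite -(count_MRD_codes inv_f) -sum1_count; apply: eq_bigl => C; rewrite inv_f.
Qed.

End BinaryCodes.

Theorem corollary4p2 (m : nat) (L : fieldExtType 'F_2) :
  (2 <= m)%N -> \dim {:L} = m ->
  exists codes : seq {vspace 'rV[L]_m},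
    [/\ uniq codes,
        forall C : {vspace 'rV[L]_m}, C \in codes <-> is_MRD 2 C
      & (size codes)%:R =
          (totient m)%:R / 2 * (#|'GL_m(2)%g|%:R / (2 ^+ m - 1)) :> rat].
Proof.
case: m => // n n0 dimL; exists (MRD_codes L n); split.
- by rewrite filter_uniq // undup_uniq.
- exact: MRD_codesP.
have := size_MRD_codes n0 dimL.
have q1 : (2 ^ n.+1).-1%:R = 2 ^+ n.+1 - 1 :> rat.
  by rewrite -subn1 natrB ?expn_gt0 // natrX.
have q1_neq0 : 2 ^+ n.+1 - 1 != 0 :> rat.
  rewrite -q1 Num.Theory.pnatr_eq0 -lt0n -ltnS prednK ?expn_gt0 //.
  by rewrite -[1%N](expn0 2) ltn_exp2l.
move/(congr1 (fun k => k%:R : rat)); rewrite !natrM q1 => sizeE.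
rewrite mulrACA -natrM [(totient _ * _)%N]mulnC natrM -sizeE -invfM mulfK //.
by rewrite mulf_neq0.
Qed.
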